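(* Let $p\ge1$ be an integer and let $\mathbb{Q}^N_{0:T}$ be the dSMC approximation of $\mathbb{Q}_{0:T}$ with $N$ particles and multinomial resampling, built along an ordered binary tree of depth $D$ with leaves $0,1,\dots,T$. Let $C^p_{0:T}$ be the constant of its $\mathcal{L}_p$ error bound, i.e. (independently of $N$ and of the bounded measurable function $\varphi$) $$\mathbb{E}\left[\left|\mathbb{Q}_{0:T}(\varphi)-\mathbb{Q}^N_{0:T}(\varphi)\right|^p\right]^{1/p}\le C^p_{0:T}\frac{\|\varphi\|_\infty}{N^{1/2}},$$ obtained by propagating the $\mathcal{L}_p$ bounds from the leaves to the root of the tree as described in the context. If the functions $\omega_c/Z_c$ are uniformly bounded by some constant $\Omega$ independent of $c$, then $$C^p_{0:T}=O\left((4\Omega)^D\right).$$ In particular, if the tree is balanced, i.e. $D=\lceil\log_2(T)\rceil$, then $$C^p_{0:T}=O\left(T^{2+\log_2(\Omega)}\right).$$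
   Context: $\mathcal{X}$ is the state space (a measurable space), $T\ge1$ an integer, $P_t(\mathrm{d}x_t\mid x_{t-1})$, $t=1,\dots,T$, are Markov kernels on $\mathcal{X}$, and $h_t:\mathcal{X}\to[0,\infty)$ are measurable potential functions. $(\nu_t)_{t=0}^T$ are probability measures on $\mathcal{X}$ such that for all $t>0$ and all $x_{t-1}$, $P_t(\cdot\mid x_{t-1})$ is absolutely continuous with respect to $\nu_t$. For $0\le a\le b\le T$, $$\mathbb{Q}_{a:b}(\mathrm{d}x_{a:b})=\frac1{L_{a:b}}\left[\nu_a(\mathrm{d}x_a)\prod_{t=a+1}^bP_t(\mathrm{d}x_t\mid x_{t-1})\right]\prod_{t=a+1}^bh_t(x_t),$$ where $L_{a:b}$ is the normalizing constant (assumed positive) and empty products equal $1$, so $\mathbb{Q}_{a:a}=\nu_a$, $L_{a:a}=1$. The weight function is the Radon–Nikodym derivative $\omega_c(x_{c-1},x_c)=\frac{P_c(\mathrm{d}x_c\mid x_{c-1})h_c(x_c)}{\nu_c(\mathrm{d}x_c)}$. Tree: an ordered binary tree on $\{0,\dots,T\}$ has root the interval $0:T$; each node $a:b$ with $a<b$ has two children $a:c-1$ and $c:b$ for some split point $c$ with $a<c\le b$; nodes $a:a$ are leaves. Each $c\in\{1,\dots,T\}$ is the split point of exactly one node $a:b$, and for that node $Z_c:=L_{a:b}/(L_{a:c-1}L_{c:b})=\iint\omega_c(x_{c-1},x_c)\,\mathbb{Q}_{a:c-1}(\mathrm{d}x_{c-1})\,\mathbb{Q}_{c:b}(\mathrm{d}x_c)$.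 $D$ is the depth of the tree. dSMC (de-Sequentialized Monte Carlo): let $q_0,\dots,q_T$ be proposal probability measures on $\mathcal{X}$ with $\nu_c$ absolutely continuous with respect to $q_c$. At each leaf $c:c$, independently over leaves, draw $X_c^1,\dots,X_c^N$ i.i.d. from $q_c$, give them normalized importance weights $w_c^n\propto\frac{\mathrm{d}\nu_c}{\mathrm{d}q_c}(X_c^n)$, $\sum_nw_c^n=1$, and set $\mathbb{Q}^N_{c:c}=\sum_nw_c^n\delta_{X^n_c}$. At an internal node $a:b$ with split point $c$, given the independent children approximations $\mathbb{Q}^N_{a:c-1}=\sum_nw_{c-1}^n\delta_{X^n_{a:c-1}}$ and $\mathbb{Q}^N_{c:b}=\sum_nw_c^n\delta_{X^n_{c:b}}$ (the weights of a child that is not a leaf are all $1/N$), draw pairs $(l_n,r_n)$, $n=1,\dots,N$, conditionally i.i.d. from $\{1,\dots,N\}^2$ with probabilities $$W_c^{ij}=\frac{w_{c-1}^iw_c^j\,\omega_c(X^i_{c-1},X^j_c)}{\sum_{i',j'=1}^Nw_{c-1}^{i'}w_c^{j'}\,\omega_c(X^{i'}_{c-1},X^{j'}_c)}$$ (multinomial resampling), and set $\mathbb{Q}^N_{a:b}=\frac1N\sum_n\delta_{[X^{l_n}_{a:c-1},X^{r_n}_{c:b}]}$, where $[\cdot,\cdot]$ is concatenation of paths. $\mathbb{Q}^N_{0:T}$ is the output at the root. Constants: for a node $a:b$ of the tree, $C^p_{a:b}$ denotes a constant, independent of $N$ and $\varphi$, such that $\mathbb{E}[|\mathbb{Q}_{a:b}(\varphi)-\mathbb{Q}^N_{a:b}(\varphi)|^p]^{1/p}\le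 C^p_{a:b}\|\varphi\|_\infty N^{-1/2}$ for all bounded measurable $\varphi$. If the two children of $a:b$ satisfy such bounds with constants $C^p_{a:c-1}$ and $C^p_{c:b}$, and $\omega_c$ is bounded, then $a:b$ satisfies it with $C^p_{a:b}=4\min(C^p_{a:c-1},C^p_{c:b})\,\|\omega_c/Z_c\|_\infty+2^{(p+1)/p}$; the constants are propagated from the leaf constants $C^p_{c:c}$ to the root by this rule. Here $\mu(f)=\int f\,\mathrm{d}\mu$ and $\|\cdot\|_\infty$ is the supremum norm. *)

(* Defs.v *)
From HB Require Import structures.
From mathcomp Require Export all_boot all_order all_algebra.
From mathcomp Require Export all_classical all_reals all_analysis.

Export Order.TTheory GRing.Theory Num.Theory.
Export numFieldNormedType.Exports.

#[export] Set Implicit Arguments.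
#[export] Unset Strict Implicit.
#[export] Unset Printing Implicit Defensive.

#[global] Open Scope classical_set_scope.
#[global] Open Scope ring_scope.

(** [otree a b] is the type of trees whose root is the
    interval [a:b] and whose leaves are [a, a+1, ..., b], in this order. *)
Inductive otree : nat -> nat -> Type :=
| leaf (a : nat) : otree a a
| node (a c b : nat) of (a < c <= b)%N & otree a c.-1 & otree c b : otree a b.

(** Number of edges on a longest path from the root to a leaf. *)
Fixpoint depth (a b : nat) (t : otree a b) : nat :=
  match t with
  | leaf _ => 0
  | node _ _ _ _ l r => (maxn (depth l) (depth r)).+1
  end.

(** The triples (a, c, b) such that a:b is an internal node split at c. *)
Fixpoint nodes (a b : nat) (t : otree a b) : seq (nat * nat * nat) :=
  match t with
  | leaf _ => [::]
  | node a c b _ l r => (a, c, b) :: nodes l ++ nodes r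
  end.

(** [up_log 2 n] is the ceiling of log_2 n for n >= 1. A balanced tree has depth
    up_log 2 of its number of leaves, which is T.+1 for the interval 0:T; with
    [up_log 2 T] instead, there is no such tree when T is a power of 2. Both
    readings of "balanced" are admitted. *)
Definition balanced (T : nat) (t : otree 0 T) : Prop :=
  depth t = up_log 2 T \/ depth t = up_log 2 T.+1.

(** A path is a function of absolute time; only the times of the interval
    under consideration are meaningful. *)
Section Paths.
Context {X : Type}.

Definition update (x : nat -> X) (t : nat) (y : X) : nat -> X :=
  fun s => if s == t then y else x s.

Definition concat (c : nat) (x y : nat -> X) : nat -> X :=
  fun s => if (s < c)%N then x s else y s.

Definition segment (a b : nat) (x : nat -> X) : (b - a).+1.-tuple X :=
  [tuple x (a + i)%N | i < (b - a).+1].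

End Paths.

Definition supnorm {R : realType} {A : Type} (f : A -> R) : R :=
  sup (range (fun x => `|f x|)).

(** Uniform weights are used on the degenerate event that all the unnormalized
    weights vanish, where the usual formula is 0/0. *)
Definition normalize {R : realType} {J : finType} (u : J -> R) (j : J) : R :=
  if \sum_i u i == 0 then #|J|%:R^-1 else u j / \sum_i u i.

(** [weight] is omega_t(x_{t-1}, x_t) and [lweight] is d nu_t / d q_t. *)
Record fk_model (R : realType) (d : measure_display) (X : measurableType d) :=
  FKModel {
    trans : nat -> R.-pker X ~> X;
    potential : nat -> X -> R;
    ref : nat -> probability X R;
    proposal : nat -> probability X R;
    weight : nat -> X -> X -> R;
    lweight : nat -> X -> R }.

Section FeynmanKac.
Context {R : realType} {d : measure_display} {X : measurableType d}.
Variable M : fk_model R X.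
Local Open Scope ereal_scope.

(** The integral of F against
    P_{t+1}(dx_{t+1} | x_t) h_{t+1}(x_{t+1}) ... P_{t+k}(dx_{t+k} | x_{t+k-1}) h_{t+k}(x_{t+k})
    given the path [x] up to time t. *)
Fixpoint trans_int (k t : nat) (F : (nat -> X) -> \bar R) (x : nat -> X) : \bar R :=
  match k with
  | 0 => F x
  | k'.+1 => \int[trans M t.+1 (x t)]_y
               ((potential M t.+1 y)%:E * trans_int k' t.+1 F (update x t.+1 y))
  end.

Definition path_int (a b : nat) (F : (nat -> X) -> \bar R) : \bar R :=
  \int[ref M a]_y trans_int (b - a) a F (fun=> y).

Definition normcst (a b : nat) : \bar R := path_int a b (cst 1).

Definition Q (a b : nat) (phi : (b - a).+1.-tuple X -> R) : R :=
  fine (path_int a b (fun x => (phi (segment a b x))%:E)) / fine (normcst a b).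

Definition Z (a c b : nat) : R :=
  fine (normcst a b) / (fine (normcst a c.-1) * fine (normcst c b)).

Record fk_valid (T : nat) : Prop := FKValid {
  potential_ge0 : forall t x, (0 < t <= T)%N -> (0 <= potential M t x)%R;
  measurable_potential : forall t, (0 < t <= T)%N ->
    measurable_fun [set: X] (potential M t);
  trans_dominated : forall t x, (0 < t <= T)%N -> trans M t x `<< ref M t;
  normcst_gt0 : forall a b, (a <= b <= T)%N -> 0 < normcst a b < +oo;
  weight_ge0 : forall t x y, (0 < t <= T)%N -> (0 <= weight M t x y)%R;
  measurable_weight : forall t, (0 < t <= T)%N ->
    measurable_fun [set: X * X] (fun xy => weight M t xy.1 xy.2);
  weight_density : forall t x A, (0 < t <= T)%N -> measurable A ->
    \int[trans M t x]_(y in A) (potential M t y)%:E =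
    \int[ref M t]_(y in A) (weight M t x y)%:E;
  ref_dominated : forall t, (t <= T)%N -> ref M t `<< proposal M t;
  lweight_ge0 : forall t x, (t <= T)%N -> (0 <= lweight M t x)%R;
  measurable_lweight : forall t, (t <= T)%N ->
    measurable_fun [set: X] (lweight M t);
  lweight_density : forall t A, (t <= T)%N -> measurable A ->
    ref M t A = \int[proposal M t]_(y in A) (lweight M t y)%:E }.

End FeynmanKac.

(** Random variables of a run with N particles: [draw c n] is the n-th proposal
    at the leaf c and [anc c n] is the pair (l_n, r_n) at the node split at c. *)
Section DSMC.
Context {R : realType} {d : measure_display} {X : measurableType d}.
Variables (M : fk_model R X) (N : nat).
Context {d' : measure_display} {S : measurableType d'}.
Variables (Pr : probability S R) (draw : nat -> 'I_N -> S -> X).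
Variable anc : nat -> 'I_N -> S -> 'I_N * 'I_N.

Fixpoint particle (a b : nat) (t : otree a b) (n : 'I_N) (w : S) : nat -> X :=
  match t with
  | leaf a => fun=> draw a n w
  | node _ c _ _ l r =>
      concat c (particle l (anc c n w).1 w) (particle r (anc c n w).2 w)
  end.

Definition particle_weight (a b : nat) (t : otree a b) (n : 'I_N) (w : S) : R :=
  match t with
  | leaf a => normalize (fun i => lweight M a (draw a i w)) n
  | node _ _ _ _ _ _ => N%:R^-1
  end.

Definition pair_prob (a c b : nat) (l : otree a c.-1) (r : otree c b) (w : S)
    : 'I_N * 'I_N -> R :=
  normalize (fun ij => particle_weight l ij.1 w * particle_weight r ij.2 w *
    weight M c (particle l ij.1 w c.-1) (particle r ij.2 w c)).

Definition QN (a b : nat) (t : otree a b) (phi : (b - a).+1.-tuple X -> R)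
    (w : S) : R :=
  \sum_n particle_weight t n w * phi (segment a b (particle t n w)).

(** Basic events generating the sigma-algebra of all the random variables of the
    subtree t; together with the empty set they form a pi-system. *)
Fixpoint events (a b : nat) (t : otree a b) : set (set S) :=
  match t with
  | leaf a => [set E | exists2 A : 'I_N -> set X, (forall n, measurable (A n)) &
                E = [set w | forall n, A n (draw a n w)]]
  | node _ c _ _ l r => [set E | exists El Er (g : 'I_N -> 'I_N * 'I_N),
      [/\ events l El, events r Er &
          E = El `&` Er `&` [set w | forall n, anc c n w = g n]]]
  end.

(** At a node: the two children are independent and, conditionally on them, the
    pairs (l_n, r_n) are i.i.d. with probabilities W_c. *)
Fixpoint dSMC (a b : nat) (t : otree a b) : Prop :=
  match t with
  | leaf a =>
      (forall n, measurable_fun [set: S] (draw a n)) /\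
      (forall A : 'I_N -> set X, (forall n, measurable (A n)) ->
        Pr [set w | forall n, A n (draw a n w)] =
        (\prod_n proposal M a (A n))%E)
  | node _ c _ _ l r =>
      [/\ dSMC l, dSMC r,
        forall n ij, measurable [set w | anc c n w = ij],
        forall El Er, events l El -> events r Er ->
          Pr (El `&` Er) = (Pr El * Pr Er)%E &
        forall El Er (g : 'I_N -> 'I_N * 'I_N), events l El -> events r Er ->
          Pr (El `&` Er `&` [set w | forall n, anc c n w = g n]) =
          (\int[Pr]_(w in El `&` Er) (\prod_n pair_prob l r w (g n))%:E)%E]
  end.

End DSMC.

Section LpBounds.
Context {R : realType} {d : measure_display} {X : measurableType d}.
Variables (p : nat) (M : fk_model R X).

Definition Lp_bound (a b : nat) (t : otree a b) (C : R) : Prop :=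
  forall (N : nat) (d' : measure_display) (S : measurableType d')
    (Pr : probability S R) (draw : nat -> 'I_N -> S -> X)
    (anc : nat -> 'I_N -> S -> 'I_N * 'I_N)
    (phi : (b - a).+1.-tuple X -> R),
  (0 < N)%N -> dSMC M Pr draw anc t ->
  measurable_fun [set: (b - a).+1.-tuple X] phi ->
  (exists B, forall x, `|phi x| <= B) ->
  (Lnorm Pr p%:R%:E (fun w => (Q M phi - QN M draw anc t phi w)%:E) <=
   (C * supnorm phi / Num.sqrt N%:R)%:E)%E.

Fixpoint Lp_const (C0 : nat -> R) (a b : nat) (t : otree a b) : R :=
  match t with
  | leaf a => C0 a
  | node a c b _ l r =>
      4 * Num.min (Lp_const C0 l) (Lp_const C0 r) *
        supnorm (fun xy => weight M c xy.1 xy.2 / Z M a c b)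
      + 2 `^ (p.+1%:R / p%:R)
  end.

(** The one-step error propagation property, for the constants [Lp_const]. It is
    a property of the model and of the leaf constants, not a general fact. *)
Fixpoint Lp_propagation (C0 : nat -> R) (a b : nat) (t : otree a b) : Prop :=
  match t with
  | leaf _ => True
  | node a c b H l r =>
      [/\ Lp_propagation C0 l, Lp_propagation C0 r &
          (Lp_bound l (Lp_const C0 l) -> Lp_bound r (Lp_const C0 r) ->
           Lp_bound (node H l r) (Lp_const C0 (node H l r)))]
  end.

End LpBounds.

(* Main.v *)
Require Import Defs.
From mathcomp Require Import measurable_realfun lra zify.

(** With x = 4 Omega and kappa = 2^((p+1)/p), the recursion reads
    C(node) <= x min(C(left), C(right)) + kappa, whence
    C(t) <= (B + kappa) x^depth(t) - kappa as soon as x >= 2. That x >= 2, and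
    even Omega >= 1, comes from the model: the mean of omega_c / Z_c under the
    product of the two children distributions is 1, which is checked at a node
    whose children are both leaves, every nontrivial tree having one. *)

Lemma otree_leq a b (t : otree a b) : (a <= b)%N.
Proof.
by elim: t => // {}a c {}b /andP[ac cb] *; exact: leq_trans (ltnW ac) cb.
Qed.

Lemma mem_nodes_leq a b (t : otree a b) a' c b' :
  (a', c, b') \in nodes t -> [&& a <= a', a' < c, c <= b' & b' <= b]%N.
Proof.
elim: t => // {}a c1 {}b /andP[ac cb] l IHl r IHr /=.
rewrite inE mem_cat => /or3P[/eqP[-> -> ->]|/IHl|/IHr]; lia.
Qed.

(** Descend into any child that still has at least two leaves; where neither child has, the split
    forces [c = b = a.+1]. *)
Lemma exists_cherry a b (t : otree a b) : (a < b)%N ->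
  exists k, (k, k.+1, k.+1) \in nodes t.
Proof.
elim: t => [{}a|{}a c {}b acb l IHl r IHr ab]; first by rewrite ltnn.
have [/IHl[k kl]|ca] := ltnP a c.-1.
  by exists k; rewrite /= inE mem_cat kl orbT.
have [/IHr[k kr]|bc] := ltnP c b.
  by exists k; rewrite /= inE mem_cat kr !orbT.
have cE : c = a.+1 by lia.
have bE : b = a.+1 by lia.
exists a; rewrite /= inE; apply/orP; left.
by rewrite !xpair_eqE cE bE !eqxx.
Qed.

Section Model.
Context {R : realType} {d : measure_display} {X : measurableType d}.
Variables (M : fk_model R X) (T : nat).
Hypothesis MT : fk_valid M T.

Lemma Z_gt0 a c b : (a < c <= b)%N -> (b <= T)%N -> 0 < Z M a c b.
Proof.
move=> acb bT.
by rewrite /Z !(mulr_gt0, invr_gt0) // fine_gt0 // (normcst_gt0 MT); lia.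
Qed.

Lemma normcst_leaf a : normcst M a a = 1%E.
Proof.
rewrite /normcst /path_int subnn /= integral_cst// mul1e.
exact: probability_setT.
Qed.

Lemma normcst_cherry k : (k < T)%N ->
  normcst M k k.+1 =
  (\int[ref M k]_y \int[ref M k.+1]_z (weight M k.+1 y z)%:E)%E.
Proof.
move=> kT; rewrite /normcst /path_int subSnn /=.
apply: eq_integral => y _; rewrite -(weight_density MT)//.
by apply: eq_integral => z _; rewrite mule1.
Qed.

(** Leaves have normalizing constant 1, so here [Z] is the integral of the weight against the
    product of two reference probabilities. Integrating the pointwise bound gives [Z <= Omega * Z],
    with [Z] positive and finite. *)
Lemma weight_ratio_ge1 k (Omega : R) : (k < T)%N ->
  (forall x y, weight M k.+1 x y / Z M k k.+1 k.+1 <= Omega) -> 1 <= Omega.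
Proof.
move=> kT bnd.
have ZE : Z M k k.+1 k.+1 = fine (normcst M k k.+1).
  by rewrite /Z /= !normcst_leaf /= mulr1 divr1.
have Lfin : normcst M k k.+1 \is a fin_num.
  have /andP[L0 Ly] := normcst_gt0 MT (a := k) (b := k.+1) ltac:(lia).
  by rewrite fin_real// Ly (lt_trans _ L0) ?ltNy0.
have Z0 : 0 < Z M k k.+1 k.+1 by apply: Z_gt0; lia.
have w_le x y : weight M k.+1 x y <= Omega * Z M k k.+1 k.+1.
  by rewrite -ler_pdivrMr.
have w_ge0 x y : 0 <= weight M k.+1 x y by apply: (weight_ge0 MT); lia.
have /measurable_EFinP mw := measurable_weight MT (t := k.+1) ltac:(lia).
have L_le : (normcst M k k.+1 <= (Omega * Z M k k.+1 k.+1)%:E)%E.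
  rewrite normcst_cherry//.
  have inner y : (\int[ref M k.+1]_z (weight M k.+1 y z)%:E <=
                  (Omega * Z M k k.+1 k.+1)%:E)%E.
    rewrite -[leRHS]mule1 -(probability_setT (ref M k.+1)) -integral_cst//.
    apply: ge0_le_integral => //= [z _||z _]; rewrite ?lee_fin//.
    exact: (measurableT_comp mw (measurable_pair1 y)).
  rewrite -[leRHS]mule1 -(probability_setT (ref M k)) -integral_cst//.
  apply: ge0_le_integral => //= [y _|].
    by apply: integral_ge0 => z _; rewrite lee_fin.
  apply: (measurable_fun_fubini_tonelli_F (m2 := ref M k.+1) _ mw) => xy.
  by rewrite lee_fin.
by move: L_le; rewrite -(fineK Lfin) lee_fin -ZE -ler_pdivrMr// divff ?gt_eqF.
Qed.

End Model.

Lemma supnorm_itv (R : realType) (A : pointedType) (f : A -> R) (C : R) :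
  (forall x, 0 <= f x <= C) -> 0 <= supnorm f <= C.
Proof.
move=> fC.
have ubC : ubound (range (fun x => `|f x|)) C.
  by move=> _ [x _ <-]; have /andP[f0 fx] := fC x; rewrite ger0_norm.
(* A real [sup] is a default value unless the set is nonempty and bounded above: [point] gives the
   first, [C] the second. *)
apply/andP; split.
  apply: (le_trans (normr_ge0 (f point))); apply: ub_le_sup; last by exists point.
  by exists C.
by apply: ge_sup => //; exists `|f point|; exists point.
Qed.

Section Recursion.
Context {R : realType} {d : measure_display} {X : measurableType d}.
Variables (p : nat) (M : fk_model R X) (C0 : nat -> R) (B Omega : R).
Let kappa : R := 2 `^ (p.+1%:R / p%:R).

(** Subtracting [kappa] makes the induction close: multiplied by [4 * Omega], it absorbs the
    additive [kappa] of each node. Nonnegativity is carried along so that upper bounds may be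
    multiplied. *)
Lemma Lp_const_itv a b (t : otree a b) :
  1 <= Omega ->
  (forall c, (a <= c <= b)%N -> 0 <= C0 c <= B) ->
  (forall a' c b', (a', c, b') \in nodes t ->
    0 <= supnorm (fun xy => weight M c xy.1 xy.2 / Z M a' c b') <= Omega) ->
  0 <= Lp_const p M C0 t <= (B + kappa) * (4 * Omega) ^+ depth t - kappa.
Proof.
move=> Omega1; have kappa0 : 0 <= kappa by exact: powR_ge0.
elim: t => [{}a|{}a c {}b acb l IHl r IHr] C0B wO.
  by rewrite /= expr0 mulr1 addrK; apply: C0B; rewrite leqnn.
have lb := otree_leq l; have rb := otree_leq r.
have {IHl} /andP[l0 lB] := IHl
  ltac:(by move=> ? ?; apply: C0B; lia)
  ltac:(by move=> ? ? ? h; apply: wO; rewrite /= inE mem_cat h orbT).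
have {IHr} /andP[r0 rB] := IHr
  ltac:(by move=> ? ?; apply: C0B; lia)
  ltac:(by move=> ? ? ? h; apply: wO; rewrite /= inE mem_cat h !orbT).
have /andP[w0 wle] := wO a c b ltac:(by rewrite /= inE eqxx).
have B0 : 0 <= B by have := C0B a ltac:(lia); lra.
rewrite /= -/kappa; set m := Num.min _ _; set s := supnorm _.
have m0 : 0 <= m by rewrite le_min l0.
rewrite addr_ge0 ?mulr_ge0//=.
set D := maxn _ _.
have mD : m <= (B + kappa) * (4 * Omega) ^+ D - kappa.
  (* Either child would do: [D] dominates both depths and the base is at least 1. *)
  rewrite ge_min; apply/orP; left; apply: (le_trans lB).
  rewrite lerD2r ler_wpM2l ?addr_ge0// ler_weXn2l ?leq_maxl//; lra.
have ms : m * s <= ((B + kappa) * (4 * Omega) ^+ D - kappa) * Omega.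
  exact: ler_pM.
have kO : kappa <= kappa * Omega by rewrite ler_peMr.
rewrite exprS; lra.
Qed.

Lemma Lp_bound_root a b (t : otree a b) :
  (forall c, (a <= c <= b)%N -> Lp_bound p M (leaf c) (C0 c)) ->
  Lp_propagation p M C0 t -> Lp_bound p M t (Lp_const p M C0 t).
Proof.
elim: t => [{}a|{}a c {}b acb l IHl r IHr] leafB.
  by move=> _; apply: leafB; rewrite leqnn.
have lb := otree_leq l; have rb := otree_leq r.
by case=> /IHl lB /IHr rB; apply; [apply: lB|apply: rB] => e eb;
  apply: leafB; lia.
Qed.

End Recursion.

(** Both readings of balanced are covered by [T < 2 ^ (trunc_log 2 T).+1]. *)
Lemma balanced_depth T (t : otree 0 T) : balanced t ->
  (depth t <= (trunc_log 2 T).+1)%N.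
Proof.
have lt_T := trunc_log_ltn T (erefl : 1 < 2)%N.
by case=> ->; apply: up_log_min => //; exact: (ltnW lt_T).
Qed.

Lemma expr_trunc_log_le (R : realType) (Omega : R) (T : nat) : 1 <= Omega ->
  (0 < T)%N -> (4 * Omega) ^+ trunc_log 2 T <= T%:R `^ (2 + ln Omega / ln 2).
Proof.
move=> Omega1 T0; set k := trunc_log 2 T; set s := 2 + _.
have ln2 : 0 < ln (2 : R) by rewrite ln_gt0// ltr1n.
have s0 : 0 <= s by rewrite addr_ge0// divr_ge0 ?ln_ge0// ler1n.
(* Exchanging the exponents [k] and [s] then leaves [2 ^ k <= T] raised to the power [s >= 0]. *)
have -> : 4 * Omega = 2 `^ s.
  rewrite /s powRD ?pnatr_eq0 ?implybT//; congr (_ * _).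
    by rewrite powR_mulrn// expr2 -natrM.
  by rewrite /powR pnatr_eq0/= divfK ?gt_eqF// lnK// posrE; lra.
rewrite -powR_mulrn ?powR_ge0// -powRrM mulrC powRrM powR_mulrn//.
rewrite ge0_ler_powR// ?nnegrE// -natrX ler_nat.
exact: trunc_logP.
Qed.

Theorem corollary2p1 (R : realType) (p : nat) (Omega B : R) :
  (0 < p)%N ->
  exists K : R,
  forall (d : measure_display) (X : measurableType d) (M : fk_model R X)
    (T : nat) (t : otree 0 T) (C0 : nat -> R),
  (0 < T)%N ->
  fk_valid M T ->
  (forall c, (c <= T)%N -> Lp_bound p M (leaf c) (C0 c)) ->
  (forall c, (c <= T)%N -> 0 <= C0 c <= B) ->
  (forall a c b, (a, c, b) \in nodes t ->
    forall x y, weight M c x y / Z M a c b <= Omega) ->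
  [/\ Lp_propagation p M C0 t -> Lp_bound p M t (Lp_const p M C0 t),
      `|Lp_const p M C0 t| <= K * (4 * Omega) ^+ depth t &
      balanced t ->
        `|Lp_const p M C0 t| <= K * T%:R `^ (2 + ln Omega / ln 2)].
Proof.
move=> _; pose kappa : R := 2 `^ (p.+1%:R / p%:R).
(* The factor [4 * Omega] pays for the level by which a balanced depth may exceed the rounded-down
   logarithm of [T]. The constant is fixed before the model and the tree, so the bounds are uniform
   in both. *)
exists ((B + kappa) * (4 * Omega)) => d X M T t C0 T0 MT leafB C0B wO.
have Omega1 : 1 <= Omega.
  have [k kt] := exists_cherry t T0; have := mem_nodes_leq kt.
  by move=> kT; apply: (weight_ratio_ge1 MT (k := k)); [lia|exact: wO].
have wO' a c b : (a, c, b) \in nodes t ->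
    0 <= supnorm (fun xy => weight M c xy.1 xy.2 / Z M a c b) <= Omega.
  move=> acb; have abT := mem_nodes_leq acb.
  apply: supnorm_itv => xy; rewrite wO// andbT divr_ge0//.
    by apply: (weight_ge0 MT); lia.
  by apply: ltW; apply: (Z_gt0 MT); lia.
have kappa0 : 0 <= kappa by exact: powR_ge0.
have B0 : 0 <= B by have := C0B 0%N (leq0n _); lra.
have /andP[C_ge0 C_le] := Lp_const_itv (a := 0) p Omega1 C0B wO'.
have Cdepth : `|Lp_const p M C0 t| <= (B + kappa) * (4 * Omega) ^+ depth t.
  by rewrite ger0_norm//; move: C_le; rewrite -/kappa; lra.
split.
- by apply: Lp_bound_root => c /leafB.
- apply: (le_trans Cdepth); rewrite -mulrA ler_wpM2l ?addr_ge0//.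
  (* The spare factor [4 * Omega] of the witness is at least 1. *)
  by rewrite ler_peMl ?exprn_ge0//; lra.
- move=> /balanced_depth dt; apply: (le_trans Cdepth).
  rewrite -mulrA ler_wpM2l ?addr_ge0//.
  apply: (@le_trans _ _ ((4 * Omega) ^+ (trunc_log 2 T).+1)).
    by rewrite ler_weXn2l//; lra.
  by rewrite exprS ler_wpM2l ?expr_trunc_log_le//; lra.
Qed.
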